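(* Let $G$ be a finite metabelian group and let $[G,G]\cong C_{p_1^{e_1}}\times\dots\times C_{p_k^{e_k}}$ be the expression of its commutator subgroup as a direct product of cyclic factors of prime power order. If the factors are pairwise nonisomorphic, then $G$ is SEP.
   Context: $C_m$ denotes the cyclic group of order $m$; the $p_i$ are primes (not necessarily distinct) and $e_i\ge 1$. A group is metabelian if it has an abelian normal subgroup with abelian quotient. Representations are nonzero, finite-dimensional, over $\mathbb{C}$. A finite group $G$ is called SEP if for every pair of noncommuting elements $x,y\in G$ there exists a representation $\rho$ of $G$ such that $\rho(x)$ and $\rho(y)$ do not share a common eigenvector. *)

(* Defs.v *)
(* The complex numbers are R[i], for R : realType a model of the reals. *)
From HB Require Import structures.
From mathcomp Require Export all_boot all_order all_algebra all_fingroup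
  all_solvable mxrepresentation reals complex.

Set Implicit Arguments.
Unset Strict Implicit.
Unset Printing Implicit Defensive.

Import GroupScope.

Definition metabelian (gT : finGroupType) (G : {group gT}) : Prop :=
  exists A : {group gT}, [/\ A <| G, abelian A & abelian (G / A)].

(* Matrices act on row vectors from the right, as everywhere in MathComp: v is
   an eigenvector of A when v != 0 and v *m A = a *: v for some a. *)
Definition is_eigenvector (F : fieldType) (n : nat) (A : 'M[F]_n)
    (v : 'rV[F]_n) : Prop :=
  v != 0%R /\ exists a : F, (v <= eigenspace A a)%MS.

Definition share_eigenvector (F : fieldType) (n : nat) (A B : 'M[F]_n) : Prop :=
  exists v : 'rV[F]_n, is_eigenvector A v /\ is_eigenvector B v.

(* The degree n must be positive: representations are nonzero, and in degree 0
   there are no eigenvectors at all. *)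
Definition SEP (R : realType) (gT : finGroupType) (G : {group gT}) : Prop :=
  forall x y : gT, x \in G -> y \in G -> ~ commute x y ->
  exists (n : nat) (rho : mx_representation R[i]%C G n),
    (0 < n)%N /\ ~ share_eigenvector (rho x) (rho y).

(* Main.v *)
(* A common eigenvector of rho x and rho y is fixed by rho [x, y], hence by
   rho z for every z in <[x, y]>; take z of prime order q.  In A = G' consider
   the characteristic chain V_m = { a^(q^m) : a in A, a^(q^(m+1)) = 1 }, which
   is the intersection of A^(q^m) with the q-torsion.  The factor V_m / V_(m+1)
   is a product of copies of C_q, one for each cyclic factor of A of order
   q^(m+1); so it has order at most q, and if m is maximal with z in V_m then
   V_m = V_(m+1) <z>.  Both groups are normal in G, so the nontrivial group
   <z V_(m+1)> is normal in G / V_(m+1), and in the regular representation of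
   this quotient a complement of its fixed space is nonzero (the representation
   is faithful) and contains no nonzero vector fixed by z. *)
Require Import Defs.

Set Implicit Arguments.
Unset Strict Implicit.
Unset Printing Implicit Defensive.

Import GroupScope.
Import GRing.Theory.

(** * Representations in which an element fixes no nonzero vector *)

Section Representations.

Variable F : fieldType.

(** Both [x * y] and [y * x] act on [v] as [a * b], which is nonzero and cancels from [x * y = y * x
    * [~ x, y]]. *)
Lemma share_eigenvector_commg (gT : finGroupType) (G : {group gT}) (n : nat)
    (rho : mx_representation F G n) (x y : gT) :
  x \in G -> y \in G -> share_eigenvector (rho x) (rho y) ->
  exists2 v : 'rV_n, v != 0%R & (v *m rho [~ x, y] = v)%R.
Proof.
move=> Gx Gy [v [[v0 [a /eigenspaceP va]] [_ [b /eigenspaceP vb]]]].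
exists v => //.
have nz (g : gT) (c : F) : g \in G -> (v *m rho g = c *: v -> c != 0)%R.
  move=> Gg vc; apply: contraNneq v0 => c0.
  by rewrite -[v](repr_mxK rho Gg) vc c0 scale0r mul0mx.
have abv : ((a * b) *: v = v *m rho (x * y)%g)%R.
  by rewrite repr_mxM // mulmxA va -scalemxAl vb scalerA.
have bav : ((a * b) *: v = v *m rho (y * x)%g)%R.
  by rewrite repr_mxM // mulmxA vb -scalemxAl va scalerA mulrC.
have ab0 : (a * b != 0)%R by rewrite mulf_neq0 ?(nz _ _ Gx va) ?(nz _ _ Gy vb).
apply: (scalerI ab0).
rewrite scalemxAl {1}bav abv -mulmxA -repr_mxM; last 2 first.
- exact: groupM.
- exact: groupR.
by rewrite -commgC.
Qed.

Lemma exists_repr_rfix0 (gT : finGroupType) (G N : {group gT}) :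
  [pchar F]%R^'.-group G -> N <| G -> N :!=: 1 ->
  exists (n : nat) (rho : mx_representation F G n),
    (0 < n)%N /\ rfix_mx rho N = 0%R.
Proof.
move=> pcharG nNG ntN; pose aG := regular_repr F G.
have fixM : mxmodule aG (rfix_mx aG N) := normal_rfix_mx_module aG nNG.
have [U Umod defU dxU] := mx_Maschke_pchar aG pcharG fixM (submx1 _).
exists (\rank U), (submod_repr Umod); split.
  rewrite lt0n mxrank_eq0; apply: contraNneq ntN => U0.
  rewrite -subG1; apply: subset_trans (regular_mx_faithful F G).
  by rewrite rfix_mx_rstabC ?normal_sub // -defU U0 addsmx0.
apply/eqP; rewrite -submx0 rfix_submod ?normal_sub // capmxC.
by rewrite (mxdirect_addsP dxU) linear0 sub0mx.
Qed.

(** Modulo [W] the given normal subgroup becomes cyclic, generated by the image of [z], so fixing a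
    vector by [z] alone fixes it by that whole subgroup. *)
Lemma exists_repr_no_fixed_vector (gT : finGroupType) (G W : {group gT})
    (z : gT) :
  [pchar F]%R^'.-group G -> W <| G -> W <*> <[z]> <| G -> z \notin W ->
  exists (n : nat) (rho : mx_representation F G n),
    (0 < n)%N /\ forall v : 'rV_n, (v *m rho z = v -> v = 0)%R.
Proof.
move=> pcharG nWG nBG W'z.
have Gz : z \in G.
  by apply: (subsetP (normal_sub nBG)); rewrite mem_gen // inE cycle_id orbT.
have Nz : z \in 'N(W) := subsetP (normal_norm nWG) z Gz.
have defN : (W <*> <[z]>) / W = <[coset W z]>.
  by rewrite quotientYidl ?cycle_subG // quotient_cycle.
have nNQ : <[coset W z]> <| G / W by rewrite -defN quotient_normal.
have ntN : <[coset W z]> != 1.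
  by rewrite cycle_eq1; apply: contra W'z => /eqP/coset_idr ->.
have [|n [rho [n_gt0 fix0]]] := exists_repr_rfix0 _ nNQ ntN.
  exact: quotient_pgroup.
(* Inflation yields a representation of the preimage of [G / W]; [eqg_repr] transports it to [G]. *)
have defG : coset_morphism W @*^-1 (G / W) == G.
  by rewrite [X in X == _]quotientGK.
exists n, (eqg_repr (morphpre_repr _ rho) defG).
split=> // v /= fixv.
have fixN : <[coset W z]> \subset rstab rho v.
  by rewrite cycle_subG inE mem_quotient //=; apply/eqP.
by apply/eqP; rewrite -submx0 -fix0 -(rfix_mx_rstabC _ _ (normal_sub nNQ)).
Qed.

End Representations.

(** * The descending chain of layers in an abelian group *)

Section SocleLayer.

(* V_m in the notation above. *)
Definition socle_layer (gT : finGroupType) (p m : nat) (A : {set gT}) :=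
  [set a ^+ (p ^ m)%N | a in A & a ^+ (p ^ m.+1)%N == 1].

Variables (gT : finGroupType) (A : {group gT}) (p : nat).
Hypothesis abelA : abelian A.
Implicit Types (z : gT) (m : nat).

Lemma socle_layerP m z :
  reflect (exists a, [/\ a \in A, a ^+ (p ^ m.+1)%N = 1 & z = a ^+ (p ^ m)%N])
          (z \in socle_layer p m A).
Proof.
apply: (iffP imsetP) => [[a]|[a [Aa /eqP a1 ->]]].
  by rewrite inE => /andP[Aa /eqP a1] ->; exists a.
by exists a; rewrite ?inE ?Aa.
Qed.

Lemma group_set_socle_layer m : group_set (socle_layer p m A).
Proof.
apply/group_setP; split=> [|x y].
  by apply/socle_layerP; exists 1; rewrite !expg1n group1.
case/socle_layerP=> a [Aa a1 ->] /socle_layerP[b [Ab b1 ->]].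
have cab : commute a b by apply: (centsP abelA).
by apply/socle_layerP; exists (a * b); rewrite !expgMn // a1 b1 mulg1 groupM.
Qed.

Definition socle_layer_group m := Group (group_set_socle_layer m).

Lemma socle_layer_norm (G : {group gT}) m :
  A <| G -> G \subset 'N(socle_layer p m A).
Proof.
move=> nAG; apply/subsetP => g Gg; rewrite inE; apply/subsetP => x /imsetP[z].
case/socle_layerP=> a [Aa a1 ->] ->; apply/socle_layerP; exists (a ^ g).
by rewrite memJ_norm ?(subsetP (normal_norm nAG)) // -!conjXg a1 conj1g.
Qed.

Lemma socle_layer_sub m : socle_layer p m A \subset A.
Proof. by apply/subsetP => z /socle_layerP[a [Aa _ ->]]; apply: groupX. Qed.

Lemma socle_layerS m : socle_layer p m.+1 A \subset socle_layer p m A.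
Proof.
apply/subsetP => z /socle_layerP[a [Aa a1 ->]].
by apply/socle_layerP; exists (a ^+ p); rewrite -!expgM -!expnS groupX.
Qed.

(** The index [#|A|] is a crude bound: [a] has order [p ^ j] for some [j], and
    [j < p ^ j <= #|A|]. *)
Lemma socle_layer_eq1 z : prime p -> z \in socle_layer p #|A| A -> z = 1.
Proof.
move=> p_pr /socle_layerP[a [Aa a1 ->]]; apply/eqP; rewrite -order_dvdn.
have p_oa : p.-nat #[a].
  apply: (pnat_dvd (n := (p ^ #|A|.+1)%N)); first by rewrite order_dvdn a1.
  by rewrite pnatX pnat_id.
rewrite -(part_pnat_id p_oa) p_part dvdn_exp2l //.
apply: leq_trans (ltnW (ltn_logl p (order_gt0 a))) _.
by rewrite dvdn_leq ?cardG_gt0 ?order_dvdG.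
Qed.

Lemma socle_layer_last z :
    prime p -> #[z] = p -> z \in A ->
  exists2 m, z \in socle_layer p m A & z \notin socle_layer p m.+1 A.
Proof.
move=> p_pr oz Az.
pose P m := z \notin socle_layer p m A.
have exP : exists m, P m.
  exists #|A|; apply/negP => /(socle_layer_eq1 p_pr)/eqP.
  by rewrite -order_eq1 oz => /eqP p1; rewrite p1 in p_pr.
(* The first layer missing [z] is not layer 0, which holds all elements of [A] killed by [p]. *)
case: (ex_minnP exP) => -[|m] Pm min_m.
  case/socle_layerP: Pm; exists z.
  by rewrite Az expn1 expg1 -{1}oz expg_order.
exists m => //; apply: contraT => /min_m.
by rewrite ltnn.
Qed.

End SocleLayer.

Lemma injm_socle_layer (aT rT : finGroupType) (A : {group aT})
    (f : {morphism A >-> rT}) (p m : nat) (z : aT) :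
  'injm f -> z \in A ->
  (f z \in socle_layer p m (f @* A)) = (z \in socle_layer p m A).
Proof.
move=> injf Az.
apply/socle_layerP/socle_layerP => [[b [Ab b1 fz]]|[a [Aa a1 ->]]].
  case/morphimP: Ab b1 fz => a Aa _ ->; rewrite -!morphX // => fa1 fz.
  exists a; split=> //; apply: (injmP injf); rewrite ?groupX ?group1 //.
  by rewrite fa1 morph1.
by exists (f a); rewrite mem_morphim // -!morphX // a1 morph1.
Qed.

(** * Layers of a product of cyclic groups of prime power order *)

Section CyclicFactors.

Lemma Zp_mulrn_eq0 (n k : nat) (u : 'Z_n) :
  (1 < n)%N -> ((u *+ k)%R == 0%R) = (n %| u * k)%N.
Proof.
move=> n_gt1; rewrite -[u in LHS]natr_Zp -mulrnA -val_eqE /=.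
by rewrite val_Zp_nat.
Qed.

(* The summand 'Z_(p ^ e) contributes to V_m / V_(m+1) only if p = q and
   e = m + 1. *)
Lemma Zp_socle_layerS (p q e m : nat) (u : 'Z_(p ^ e)) :
    prime p -> prime q -> (0 < e)%N -> (u *+ (q ^ m.+1)%N = 0)%R ->
    (p = q -> e = m.+1 -> u *+ (q ^ m)%N = 0)%R ->
  exists w : 'Z_(p ^ e),
    (w *+ (q ^ m.+2)%N = 0)%R /\ (u *+ (q ^ m)%N = w *+ (q ^ m.+1)%N)%R.
Proof.
move=> p_pr q_pr e_gt0 u0 top0.
have pe_gt1 : (1 < p ^ e)%N by rewrite -(exp1n e) ltn_exp2r ?prime_gt1.
have ex0 : (u *+ (q ^ m)%N = 0)%R -> exists w : 'Z_(p ^ e),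
    (w *+ (q ^ m.+2)%N = 0)%R /\ (u *+ (q ^ m)%N = w *+ (q ^ m.+1)%N)%R.
  by move=> um0; exists 0%R; rewrite um0 !mul0rn.
move/eqP: u0; rewrite Zp_mulrn_eq0 // => u0.
have [eq_pq | neq_pq] := eqVneq p q; last first.
  apply: ex0; apply/eqP; rewrite Zp_mulrn_eq0 //.
  rewrite Gauss_dvdl in u0; first exact: dvdn_mulr.
  by rewrite coprimeXl // coprimeXr // prime_coprime // dvdn_prime2.
subst q; have [le_em | lt_me] := leqP e m.
  by apply: ex0; apply/eqP; rewrite Zp_mulrn_eq0 // dvdn_mull // dvdn_exp2l.
have [eq_em | neq_em] := eqVneq e m.+1; first exact: ex0 (top0 _ eq_em).
(* Now [m.+1 < e], so [p ^ m.+2] divides [p ^ e], hence [u * p ^ m.+1]; the witness is [u / p]. *)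
have pu : (p %| u)%N.
  rewrite -(@dvdn_pmul2r (p ^ m.+1)) ?expn_gt0 ?prime_gt0 // -expnS.
  by apply: dvdn_trans u0; rewrite dvdn_exp2l // ltn_neqAle eq_sym neq_em.
exists ((u %/ p)%N%:R)%R.
have eq_u (k : nat) : ((u %/ p)%N%:R *+ (p ^ k.+1)%N = u *+ (p ^ k)%N)%R.
  by rewrite -mulrnA expnS mulnA divnK // mulrnA natr_Zp.
by rewrite !eq_u; split=> //; apply/eqP; rewrite Zp_mulrn_eq0.
Qed.

(** The nonvanishing says that [p] does not divide [u]; then [u] is a unit and [n] represents
    [w / u]. *)
Lemma Zp_socle_cyclic (p e m : nat) (u w : 'Z_(p ^ e)) :
    prime p -> e = m.+1 -> (u *+ (p ^ m)%N != 0)%R ->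
  exists n : nat, (w *+ (p ^ m)%N = u *+ (p ^ m)%N *+ n)%R.
Proof.
move=> p_pr e_m.
have pe_gt1 : (1 < p ^ e)%N by rewrite e_m -(exp1n m.+1) ltn_exp2r ?prime_gt1.
rewrite Zp_mulrn_eq0 // {1}e_m expnS dvdn_pmul2r ?expn_gt0 ?prime_gt0 // => p'u.
have Uu : u \is a GRing.unit.
  by rewrite -[u]natr_Zp unitZpE // coprimeXl // prime_coprime.
exists (w / u)%R.
by rewrite mulrnAC -[(u *+ _)%R]mulr_natr natr_Zp mulrCA divrr ?mulr1.
Qed.

Variables (k : nat) (p e : 'I_k -> nat).
Hypothesis p_prime : forall i, prime (p i).
Hypothesis e_gt0 : forall i, (0 < e i)%N.
Hypothesis factors_inj : forall i j, p i = p j -> e i = e j -> i = j.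

Local Notation P := {dffun forall i : 'I_k, 'Z_(p i ^ e i)}.

Lemma expg_dffunE (x : P) (n : nat) (i : 'I_k) : (x ^+ n) i = (x i *+ n)%R.
Proof.
elim: n => [|n IHn]; first by rewrite expg0 ffunE.
by rewrite expgS ffunE IHn mulrS.
Qed.

Lemma abelian_prod : abelian [set: P].
Proof. by apply/centsP => x _ y _; apply/ffunP => j; rewrite !ffunE Zp_mulgC. Qed.

Lemma prod_socle_layerS (q m : nat) (z : P) :
    prime q -> z \in socle_layer q m [set: P] ->
    (forall i, p i = q -> e i = m.+1 -> z i = 0%R) ->
  z \in socle_layer q m.+1 [set: P].
Proof.
move=> q_pr /socle_layerP[u [_ u1 ->]] top0.
have [i|w wP] := fin_all_exists
  (P := fun i (w : 'Z_(p i ^ e i)) => (w *+ (q ^ m.+2)%N = 0)%R /\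
    (u i *+ (q ^ m)%N = w *+ (q ^ m.+1)%N)%R).
  apply: Zp_socle_layerS => //.
    by rewrite -expg_dffunE u1 ffunE.
  by move=> pq em; rewrite -expg_dffunE top0.
apply/socle_layerP; exists (finfun w); split; rewrite ?inE //.
  by apply/ffunP => i; rewrite expg_dffunE !ffunE; case: (wP i).
by apply/ffunP => i; rewrite !expg_dffunE !ffunE; case: (wP i).
Qed.

(** Only a coordinate of order [q ^ m.+1] can obstruct descent to the next layer. As [z] does not
    descend, it is nonzero at such a coordinate; by [factors_inj] there is no other, and a power of
    [z] cancels [b] there. *)
Lemma prod_socle_layer_cyclic (q m : nat) (z b : P) :
    prime q -> z \in socle_layer q m [set: P] ->
    z \notin socle_layer q m.+1 [set: P] -> b \in socle_layer q m [set: P] ->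
  exists n : nat, b * z ^- n \in socle_layer q m.+1 [set: P].
Proof.
move=> q_pr Lz L'z Lb.
have [i zi] : exists i, [&& p i == q, e i == m.+1 & z i != 0%R].
  apply/existsP; apply: contraR L'z; rewrite negb_exists => /forallP z0.
  apply: prod_socle_layerS => // i /eqP pq /eqP em.
  by have:= z0 i; rewrite pq em negbK => /eqP.
case/and3P: zi => /eqP pq /eqP em zi_neq0.
have [n def_bi] : exists n : nat, (b i = z i *+ n)%R.
  case/socle_layerP: Lz zi_neq0 => u [_ _ ->].
  case/socle_layerP: Lb => w [_ _ ->].
  rewrite !expg_dffunE -pq; exact: Zp_socle_cyclic.
exists n.
apply: prod_socle_layerS => // [|j pj ej].
  pose L := socle_layer_group q abelian_prod m.
  by rewrite (_ : socle_layer _ _ _ = L) // groupM // groupV groupX.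
have -> : j = i by apply: factors_inj; rewrite ?pj ?ej.
by rewrite !ffunE expg_dffunE def_bi; apply: mulgV.
Qed.

End CyclicFactors.

(** * From the layers of the commutator subgroup to the separating representation *)

Theorem theorem1p1p51 (R : realType) (gT : finGroupType) (G : {group gT})
  (k : nat) (p e : 'I_k -> nat)
  (G_metabelian : metabelian G)
  (p_prime : forall i : 'I_k, prime (p i))
  (e_gt0 : forall i : 'I_k, (0 < e i)%N)
  (* 'Z_m is the cyclic group of order m when m > 1, as here *)
  (commG_prod : [~: G, G] \isog
     [set: {dffun forall i : 'I_k, 'Z_(expn (p i) (e i))}])
  (factors_noniso : forall i j : 'I_k, i != j ->
     ~ ([set: 'Z_(expn (p i) (e i))] \isog [set: 'Z_(expn (p j) (e j))])) :
  SEP R G.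
Proof.
move=> x y Gx Gy ncxy.
have factors_inj i j : p i = p j -> e i = e j -> i = j.
  move=> eq_p eq_e; apply/eqP; apply: contraT => neq_ij.
  by case: (factors_noniso i j neq_ij); rewrite eq_p eq_e isog_refl.
have [f injf imf] := isogP commG_prod.
have abelA : abelian [~: G, G].
  by rewrite -(injm_abelian injf) // imf abelian_prod.
have nAG : [~: G, G] <| G := der_normal 1 G.
have Ac : [~ x, y] \in [~: G, G] := mem_commg Gx Gy.
have oc_gt1 : (1 < #[[~ x, y]])%N.
  by rewrite order_gt1; apply/eqP => /eqP/commgP.
set q := pdiv #[[~ x, y]].
have q_pr : prime q := pdiv_prime oc_gt1.
have [z def_z oz] : exists2 z, z \in <[[~ x, y]]> & #[z] = q.
  by have [z] := @Cauchy _ q <[[~ x, y]]>%G q_pr (pdiv_dvd _); exists z.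
have Az : z \in [~: G, G] by apply: subsetP def_z; rewrite cycle_subG.
have [m Lz L'z] := socle_layer_last q_pr oz Az.
pose W := socle_layer_group q abelA m.+1; pose B := socle_layer_group q abelA m.
have nLG i : socle_layer_group q abelA i <| G.
  rewrite /normal socle_layer_norm // andbT.
  exact: subset_trans (socle_layer_sub _ _ _) (normal_sub nAG).
(* This makes [W <*> <[z]>] normal in [G]; the inclusion of [B] is checked in the product, through
   [f]. *)
have defB : W <*> <[z]> = B.
  apply/eqP; rewrite eqEsubset join_subG cycle_subG Lz socle_layerS /=.
  apply/subsetP => b Lb.
  have Ab : b \in [~: G, G] := subsetP (socle_layer_sub _ _ _) b Lb.
  have [n] : exists n : nat, f b * f z ^- n \in
      socle_layer q m.+1 [set: {dffun forall i : 'I_k, 'Z_(p i ^ e i)}].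
    apply: prod_socle_layer_cyclic => //;
      by rewrite -imf injm_socle_layer.
  rewrite -morphX // -morphV ?groupX // -morphM ?groupV ?groupX //.
  rewrite -imf injm_socle_layer ?groupM ?groupV ?groupX // => Wbz.
  rewrite -[b](mulgKV (z ^+ n)) groupM //.
    exact: (subsetP (joing_subl _ _)) Wbz.
  by rewrite (subsetP (joing_subr _ _)) // mem_cycle.
have [||n [rho [n_gt0 fix0]]] :=
    exists_repr_no_fixed_vector (F := R[i]%C) _ (nLG m.+1) _ L'z.
(* Characteristic zero: no prime is excluded. *)
- by apply/pgroupP => r _; rewrite inE /= Num.Theory.pchar_num.
- by rewrite defB; apply: nLG.
exists n, rho; split=> // /(share_eigenvector_commg Gx Gy)[v v_neq0 fix_v].
case/eqP: v_neq0; apply: fix0.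
have : <[[~ x, y]]> \subset rstab rho v.
  by rewrite cycle_subG inE groupR //= fix_v.
by move/subsetP/(_ z def_z); rewrite inE => /andP[_ /eqP].
Qed.
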